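(* Let $A=(V_A,E_A)$ be an in-arborescence with influence probabilities $p$ and meeting probabilities $m$ on its edges, let $S$ be a seed set, let $\tau\in\mathbb{Z}_+$ be a deadline, and for $u\in V_A$ and $t\in\{0,\dots,\tau\}$ let $ap(u,t)$ be the probability that $u$ is activated at step $t$ in the IC-M process on $A$ with seed set $S$. Then $ap(u,t)$ can be recursively computed as follows. If $u\in S$ or $t=0$, $$ap(u,t)=\begin{cases}1 & \text{if } u\in S,\ t=0,\\ 0 & \text{if } u\notin S,\ t=0,\\ 0 & \text{if } u\in S,\ t\in\{1,\dots,\tau\}.\end{cases}$$ If $u\notin S$ and $t\in\{1,\dots,\tau\}$, $$ap(u,t)=\prod_{w\in N^{in}(u)}\Big(1-\sum_{t'=0}^{t-2}ap(w,t')\,p(w,u)\,\big[1-(1-m(w,u))^{t-t'-1}\big]\Big)-\prod_{w\in N^{in}(u)}\Big(1-\sum_{t'=0}^{t-1}ap(w,t')\,p(w,u)\,\big[1-(1-m(w,u))^{t-t'}\big]\Big),$$ where $N^{in}(u)\subseteq V_A$ is the set of in-neighbors of $u$ in $A$.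
   Context: An in-arborescence is a finite directed tree in which all edges point toward the root. At least one seed lies in $V_A$, and influence propagates only along edges of $A$ (seeds outside $V_A$ play no role). Empty sums are $0$ and empty products are $1$. IC-M process on $A$ (Independent Cascade with Meeting events), with $p,m:E_A\to[0,1]$: time is discrete, $0,1,2,\dots$. At step $0$ exactly the seeds are active. At each step $t\ge 1$, every node $u$ that became active at a step before $t$ meets each of its currently inactive out-neighbors $v$ independently with probability $m(u,v)$ (independently over pairs and steps). If this is the first meeting of $u$ and $v$ since $u$'s activation, $u$ gets its single chance to activate $v$, succeeding independently with probability $p(u,v)$; on success $v$ becomes active at step $t$ and starts to propagate influence at step $t+1$. Active nodes stay active. *)

(* Defs.v *)
From HB Require Import structures.
From mathcomp Require Import all_boot all_order all_algebra finmap.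
From mathcomp Require Import all_classical all_reals all_analysis.

Set Implicit Arguments.
Unset Strict Implicit.
Unset Printing Implicit Defensive.

Import Order.TTheory GRing.Theory Num.Theory.

Local Open Scope classical_set_scope.
Local Open Scope ring_scope.

Section Arborescence.
Variable T : finType.
Implicit Types (VA : {set T}) (E : rel T).

Definition undirected E : rel T := [rel x y | E x y || E y x].

(* A cycle of length at least 3 with distinct vertices; cycles of length 2 in
   [undirected E] only go back and forth along one edge. *)
Definition acyclic (e : rel T) := forall c : seq T, ucycle e c -> (size c < 3)%N.

(* An orientation of a tree with vertex set VA. *)
Definition directed_tree VA E :=
  [/\ forall x y, E x y -> (x \in VA) && (y \in VA),
      forall x y, E x y -> ~~ E y x,
      {in VA &, forall x y, connect (undirected E) x y}
    & acyclic (undirected E)].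

(* The head of every edge lies on the tree path from its tail to r. *)
Definition points_toward E (r : T) :=
  forall x y, E x y ->
  forall q : seq T, path (undirected E) x q -> uniq (x :: q) ->
    last x q = r -> y \in q.

Definition in_arborescence VA E :=
  directed_tree VA E /\ exists2 r, r \in VA & points_toward E r.

Definition in_neighbors VA E (u : T) : {set T} := [set w in VA | E w u]%SET.

End Arborescence.

(* Mutual independence of the events F i, for i in D. *)
Definition mutually_independent d (Omega : measurableType d) (R : realType)
    (P : probability Omega R) (I : choiceType) (D : set I)
    (F : I -> set Omega) :=
  forall J : {fset I}, [set` J] `<=` D ->
    P (\bigcap_(i in [set` J]) F i) = (\prod_(i <- J) P (F i))%E.

Section ICM.
Variables (T : finType) (E : rel T) (S : {set T}).

(* The random choices: [M (u, v) t] is the event that u meets v at step t in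
   case u is active and v inactive just before step t, and [K (u, v) t] the
   event that u succeeds in activating v in case it gets its single chance at
   step t.  Only the choices for edges and for steps t >= 1 are ever used. *)
Definition icm_choices d (Omega : measurableType d) (R : realType)
    (P : probability Omega R) (p m : T -> T -> R)
    (M K : T * T -> nat -> set Omega) :=
  let event (c : (T * T * nat) + (T * T * nat)) :=
    match c with inl (e, t) => M e t | inr (e, t) => K e t end in
  let used (c : (T * T * nat) + (T * T * nat)) :=
    match c with inl (e, t) | inr (e, t) => E e.1 e.2 /\ (0 < t)%N end in
  [/\ forall u v t, E u v -> (0 < t)%N ->
        measurable (M (u, v) t) /\ measurable (K (u, v) t),
      forall u v t, E u v -> (0 < t)%N -> P (M (u, v) t) = (m u v)%:E,
      forall u v t, E u v -> (0 < t)%N -> P (K (u, v) t) = (p u v)%:E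
    & mutually_independent P [set c | used c] event].

Variables (Omega : Type) (M K : T * T -> nat -> set Omega).

(* The state (X, F) after a step: X is the set of active nodes, and F the set
   of edges (u, v) such that u has met v since u's activation. *)
Definition icm_step (t : nat) (omega : Omega) (st : {set T} * {set T * T}) :
    {set T} * {set T * T} :=
  let: (X, F) := st in
  let met := [set e : T * T | [&& E e.1 e.2, e.1 \in X, e.2 \notin X
                                & omega \in M e t]]%SET in
  let won := [set e in met | (e \notin F) && (omega \in K e t)]%SET in
  (X :|: [set e.2 | e in won], F :|: met)%SET.

Fixpoint icm_state (t : nat) (omega : Omega) : {set T} * {set T * T} :=
  if t is t'.+1 then icm_step t omega (icm_state t' omega) else (S, finset.set0).

Definition active_after (t : nat) (omega : Omega) : {set T} :=
  (icm_state t omega).1.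

Definition activated_at (u : T) (t : nat) (omega : Omega) : bool :=
  (u \in active_after t omega) &&
  (if t is t'.+1 then u \notin active_after t' omega else true).

End ICM.

Definition ap (T : finType) (E : rel T) (S : {set T}) d
    (Omega : measurableType d) (R : realType) (P : probability Omega R)
    (M K : T * T -> nat -> set Omega) (u : T) (t : nat) : R :=
  fine (P [set omega | activated_at E S M K u t omega]).

(* Main.v *)
(* Each node of an in-arborescence has at most one out-edge and there is no
   directed cycle, so the subtrees above distinct in-neighbors w of u are
   disjoint. Node u is active after step t iff some in-neighbor w was activated
   at a step t' < t and wins its single chance over u during the steps
   t'+1, ..., t. The first event depends only on the choices for the edges above
   w and the second only on those for (w, u), so they are independent, and
   the second has probability p (1 - (1 - m)^(t - t')); summing over t' gives
   the probability that w wins over u by step t. For distinct w these events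
   depend on disjoint sets of choices, so the probability that u is still
   inactive is the product of the complementary probabilities, and ap(u, t) is
   the difference of two consecutive such products. *)
Require Import Defs.
From HB Require Import structures.
From mathcomp Require Import all_boot all_order all_algebra finmap.
From mathcomp Require Import all_classical all_reals all_analysis.
From mathcomp Require Import ring.
Set Implicit Arguments.
Unset Strict Implicit.
Unset Printing Implicit Defensive.
Import Order.TTheory GRing.Theory Num.Theory.
Local Open Scope classical_set_scope.
Local Open Scope ring_scope.

(** * Events determined by a set of basic choices *)

Section Determined.
Variables (Omega : Type) (C : choiceType) (F : C -> set Omega).

(** Saturation under agreement on the choices in [D]. For finite [D] this amounts to membership in
    the algebra generated by the [F c], but it can be checked pointwise along the recursion of the
    process. *)
Definition determined (D : set C) (A : set Omega) :=
  forall x y, (forall c, D c -> (x \in F c) = (y \in F c)) -> A x -> A y.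

Lemma determinedS D D' A : D `<=` D' -> determined D A -> determined D' A.
Proof. by move=> DD' dA x y xy; apply: dA => c /DD'; exact: xy. Qed.

Lemma determinedC D A : determined D A -> determined D (~` A).
Proof. by move=> dA x y xy nAx Ay; apply: nAx; apply: dA Ay => c Dc; rewrite xy. Qed.

Lemma determinedI D A B :
  determined D A -> determined D B -> determined D (A `&` B).
Proof.
by move=> dA dB x y xy [Ax Bx]; split; [exact: dA Ax | exact: dB Bx].
Qed.

Lemma determined1 c : determined [set c] (F c).
Proof. by move=> x y /(_ c erefl) xy /mem_set; rewrite xy inE. Qed.

(** The smallest event determined by [D] that contains the intersection of [A] and [B]. *)
Definition section_at (D : set C) (A B : set Omega) :=
  [set x | exists2 y, (A `&` B) y & forall c, D c -> (x \in F c) = (y \in F c)].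

Lemma section_at_determined D A B : determined D (section_at D A B).
Proof.
move=> x y xy [z ABz xz]; exists z => // c Dc.
by rewrite -xy// xz.
Qed.

(** A point of [B] in the saturation agrees with its witness on [D], and also on [c] because both
    lie in [B]; so [A] cannot tell them apart. *)
Lemma section_atI D c A B :
  determined [set c' | c' = c \/ D c'] A ->
  (forall x y, B x -> B y -> (x \in F c) = (y \in F c)) ->
  section_at D A B `&` B = A `&` B.
Proof.
move=> dA cB; apply/seteqP; split => x [].
  move=> [y [Ay By] xy] Bx; split=> //; apply: dA Ay => c' [->|Dc'].
    exact: cB.
  by rewrite xy.
by move=> Ax Bx; split=> //; exists x.
Qed.

(** Conditioning on [c]: once its outcome is fixed, [A] coincides with an event that no longer looks
    at [c]. This drives the inductions on finite lists of choices. *)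
Lemma determined_split D c A : determined [set c' | c' = c \/ D c'] A ->
  exists A1 A0, [/\ determined D A1, determined D A0,
    A1 `&` F c = A `&` F c & A0 `&` ~` F c = A `&` ~` F c].
Proof.
move=> dA; exists (section_at D A (F c)), (section_at D A (~` F c)).
split; try exact: section_at_determined; apply: (section_atI dA) => x y.
  by move=> /mem_set -> /mem_set ->.
by move=> Bx By; rewrite (memNset Bx) (memNset By).
Qed.

Lemma determined_bigcap (I : eqType) (s : seq I) (D : set C)
    (A : I -> set Omega) :
  (forall i, i \in s -> determined D (A i)) ->
  determined D (\big[setI/setT]_(i <- s) A i).
Proof.
elim: s => [|i s IH] dA; first by rewrite big_nil.
rewrite big_cons; apply: determinedI; first by apply: dA; rewrite mem_head.
by apply: IH => j js; apply: dA; rewrite inE js orbT.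
Qed.

End Determined.

(** * Independence of events determined by disjoint finite sets of choices *)

Section Independence.
Variables (d : measure_display) (Omega : measurableType d) (R : realType).
Variables (P : probability Omega R) (C : choiceType) (F : C -> set Omega).

Definition pr (A : set Omega) : R := fine (P A).

Lemma prE A : measurable A -> P A = (pr A)%:E.
Proof. by move=> mA; rewrite fineK// fin_num_measure. Qed.

Lemma pr0 : pr set0 = 0. Proof. by rewrite /pr measure0. Qed.

Lemma prT : pr setT = 1. Proof. by rewrite /pr probability_setT. Qed.

Lemma pr_splitI A B : measurable A -> measurable B ->
  pr A = pr (A `&` B) + pr (A `&` ~` B).
Proof.
move=> mA mB; apply: EFin_inj; rewrite EFinD.
have mC := measurableC mB.
by rewrite -!prE; try exact: measurableI; rewrite // (measureDI P mA mB) addeC setDE.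
Qed.

Lemma prC A : measurable A -> pr (~` A) = 1 - pr A.
Proof.
move=> mA; apply/eqP; rewrite eq_sym subr_eq addrC -prT.
by rewrite (pr_splitI measurableT mA) !setTI.
Qed.

Lemma prU A B : measurable A -> measurable B -> A `&` B = set0 ->
  pr (A `|` B) = pr A + pr B.
Proof.
move=> mA mB AB0; rewrite (pr_splitI (measurableU _ _ mA mB) mA).
congr (pr _ + pr _); first by rewrite setUK.
rewrite setIUl setICr set0U; apply/setIidl => x Bx Ax.
by have : (A `&` B) x by []; rewrite AB0.
Qed.

(** Splitting on one choice at a time writes [A] as a finite union of intersections; an event
    determined by no choice is empty or the whole space. *)
Lemma determined_measurable D A : finite_set D ->
  (forall c, D c -> measurable (F c)) -> determined F D A -> measurable A.
Proof.
move=> /finite_seqP[s ->]; elim: s A => [|c s IH] A mF dA.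
  have [->//|] := eqVneq A set0.
    by move=> /set0P[x Ax]; rewrite (_ : A = setT)//; apply/seteqP; split=> // y _;
       apply: dA Ax.
have mFs c' : [set` s] c' -> measurable (F c').
  by move=> /= sc'; apply: mF; rewrite /= inE sc' orbT.
have mFc : measurable (F c) by apply: mF; rewrite /= mem_head.
have [|A1 [A0 [d1 d0 e1 e0]]] := @determined_split _ _ F [set` s] c A.
  by apply: determinedS dA => c' /=; rewrite inE => /orP[/eqP|]; [left|right].
rewrite -(setIT A) -(setUv (F c)) setIUr -e1 -e0.
have mFCc := measurableC mFc.
by apply: measurableU; apply: measurableI => //; exact: IH.
Qed.


Definition inter (s : seq C) : set Omega := \big[setI/setT]_(c <- s) F c.

(** Independence of [B] from the choices in [s], tested only on intersections of the [F c]. For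
    [B = setT] it is the mutual independence of these choices. *)
Definition product_rule (B : set Omega) (s : seq C) := forall J : seq C,
  uniq J -> {subset J <= s} ->
  pr (B `&` inter J) = pr B * \prod_(c <- J) pr (F c).

Lemma inter_measurable J : (forall c, c \in J -> measurable (F c)) ->
  measurable (inter J).
Proof.
move=> mF; rewrite /inter big_seq.
by apply: bigsetI_measurable => c; exact: mF.
Qed.

(* Induction on s, conditioning on the outcome of one choice at a time. *)
Lemma product_rule_determined s A B : uniq s ->
  (forall c, c \in s -> measurable (F c)) -> measurable B ->
  product_rule setT s -> product_rule B s -> determined F [set` s] A ->
  pr (A `&` B) = pr A * pr B.
Proof.
elim: s A B => [|c s IH] A B us mF mB pT pB dA.
  have [->|] := eqVneq A set0; first by rewrite set0I pr0 mul0r.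
  move=> /set0P[x Ax]; rewrite (_ : A = setT) ?setTI ?prT ?mul1r//.
  by apply/seteqP; split=> // y _; apply: dA Ax.
have mA := determined_measurable (finite_seq (c :: s)) mF dA.
have mFc : measurable (F c) by apply: mF; rewrite mem_head.
have mFs c' : c' \in s -> measurable (F c').
  by move=> sc'; apply: mF; rewrite inE sc' orbT.
have [|A1 [A0 [d1 d0 e1 e0]]] := @determined_split _ _ F [set` s] c A.
  by apply: determinedS dA => c' /=; rewrite inE => /orP[/eqP|]; [left|right].
have /andP[cs us'] := us.
have pI B' : product_rule B' (c :: s) ->
    pr (F c `&` B') = pr (F c) * pr B'.
  move=> pB'; have := pB' [:: c]; rewrite /inter !big_seq1 setIC mulrC; apply=> //.
  by move=> c'; rewrite inE => /eqP->; exact: mem_head.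
have sub B' : product_rule B' (c :: s) -> product_rule B' s.
  by move=> pB' J uJ Js; apply: pB' => // c' /Js; rewrite inE orbC => ->.
have subF B' : product_rule B' (c :: s) -> product_rule (F c `&` B') s.
  move=> pB' J uJ Js; rewrite pI//.
  have := pB' (c :: J); rewrite /inter !big_cons setIA (setIC B') => ->.
  - by rewrite mulrA [pr B' * _]mulrC.
  - by rewrite /= uJ andbT; apply: contra cs => /Js.
  - by move=> c'; rewrite !inE => /orP[->//|/Js ->]; rewrite orbT.
(* The rule passes to the complement of [F c] by subtracting its instance for the part of [B']
   inside [F c] from its instance for [B']. *)
have subC B' : measurable B' -> product_rule B' (c :: s) ->
    product_rule (~` F c `&` B') s.
  move=> mB' pB' J uJ Js.
  have mJ : measurable (inter J).
    by apply: inter_measurable => c' /Js; exact: mFs.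
  have := subF _ pB' J uJ Js; have := sub _ pB' J uJ Js.
  have := pr_splitI (measurableI _ _ mB' mJ) mFc.
  have := pr_splitI mB' mFc; have := pI _ pB'.
  rewrite ![B' `&` inter J `&` _]setIAC ![B' `&` F c]setIC ![B' `&` ~` F c]setIC.
  set q := \prod_(_ <- _) _ => -> h1 h2 h3 h4.
  move: h2; rewrite h3 h4 => /eqP; rewrite addrC -subr_eq => /eqP <-.
  by rewrite -mulrBl {1}h1 addrC addKr.
have eqn B' : measurable B' -> product_rule B' (c :: s) ->
    pr (A `&` B') = pr A1 * pr (F c `&` B') + pr A0 * pr (~` F c `&` B').
  move=> mB' pB'.
  rewrite (pr_splitI (measurableI _ _ mA mB') mFc).
  rewrite ![A `&` B' `&` _]setIAC -e1 -e0 -!setIA.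
  congr (_ + _); apply: IH => //.
  - exact: measurableI.
  - exact: sub.
  - exact: subF.
  - by apply: measurableI => //; exact: measurableC.
  - exact: sub.
  - exact: subC.
(* The decomposition is used for [setT] and for [B]; since [c] is independent of [B], the two differ
   by the factor [pr B]. *)
have := eqn _ measurableT pT; rewrite !setIT => ->; rewrite (eqn _ mB pB) pI//.
have -> : pr (~` F c `&` B) = pr (~` F c) * pr B.
  rewrite prC// mulrBl mul1r -pI// [in RHS](pr_splitI mB mFc) setIC.
  by rewrite [B `&` F c]setIC addrC addKr.
by rewrite mulrDl !mulrA.
Qed.

Variable U : set C.
Hypothesis F_measurable : forall c, U c -> measurable (F c).
Hypothesis F_independent : mutually_independent P U F.

Lemma pr_inter s : uniq s -> [set` s] `<=` U ->
  pr (inter s) = \prod_(c <- s) pr (F c).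
Proof.
move=> us sU; apply: EFin_inj; rewrite -prE; last first.
  by apply: inter_measurable => c /sU; exact: F_measurable.
have eqs : [set` [fset c in s]%fset] = [set` s].
  by apply/seteqP; split=> c /=; rewrite in_fset.
have := @F_independent [fset c in s]%fset; rewrite eqs => /(_ sU).
rewrite bigcap_seq => ->.
have /(perm_big _) -> : perm_eq [fset c in s]%fset s.
  by apply: uniq_perm => // c; rewrite in_fset.
rewrite -prodEFin !big_seq; apply: eq_bigr => c /sU Uc.
by rewrite prE//; exact: F_measurable.
Qed.

(** Two uses of [product_rule_determined]: the first replaces [A] by intersections over lists [J] of
    choices in [D1], the second replaces [B] by intersections over lists [J'] in [D2]. What remains
    is mutual independence for [J ++ J'], duplicate-free by disjointness. *)
Lemma determined_independent D1 D2 A B :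
  finite_set D1 -> finite_set D2 -> D1 `<=` U -> D2 `<=` U ->
  (forall c, D1 c -> ~ D2 c) -> determined F D1 A -> determined F D2 B ->
  pr (A `&` B) = pr A * pr B.
Proof.
move=> f1 f2 U1 U2 D12 dA dB.
have mB : measurable B.
  by apply: determined_measurable dB => // c /U2; exact: F_measurable.
have finU (D : set C) : finite_set D -> exists2 s, uniq s & D = [set` s].
  move=> /finite_seqP[s ->]; exists (undup s); first exact: undup_uniq.
  by apply/seteqP; split=> c /=; rewrite mem_undup.
have [s1 us1 E1] := finU _ f1; have [s2 us2 E2] := finU _ f2; subst D1 D2.
have mF s : [set` s] `<=` U -> forall c, c \in s -> measurable (F c).
  by move=> sU c /sU; exact: F_measurable.
have pT s : [set` s] `<=` U -> product_rule setT s.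
  move=> sU J uJ Js; rewrite setTI prT mul1r pr_inter// => c /Js; exact: sU.
apply: (product_rule_determined us1) => //; [exact: mF|exact: pT|].
move=> J uJ Js; have JU : [set` J] `<=` U by move=> c /Js; exact: U1.
rewrite -pr_inter//; apply: (product_rule_determined us2) => //.
- exact: mF.
- exact/inter_measurable/mF.
- exact: pT.
- move=> J' uJ' Js'; rewrite pr_inter//.
  have disj : ~~ has (mem J) J'.
    by apply/hasPn => c /Js' c2; apply/negP => /Js /D12; exact.
  have := @pr_inter (J ++ J'); rewrite /inter !big_cat /=; apply.
    by rewrite cat_uniq uJ uJ' andbT.
  by move=> c /=; rewrite mem_cat => /orP[/JU//|/Js' /U2].
Qed.

Lemma determined_independent_big (I : eqType) (s : seq I) (D : I -> set C)
    (A : I -> set Omega) : uniq s ->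
  (forall i, i \in s -> finite_set (D i)) ->
  (forall i, i \in s -> D i `<=` U) ->
  (forall i j c, i \in s -> j \in s -> D i c -> D j c -> i = j) ->
  (forall i, i \in s -> determined F (D i) (A i)) ->
  pr (\big[setI/setT]_(i <- s) A i) = \prod_(i <- s) pr (A i).
Proof.
elim: s => [|i s IH] us fD DU Dij dA; first by rewrite !big_nil prT.
have /andP[is_ us'] := us.
have ms j : j \in s -> j \in i :: s by rewrite inE orbC => ->.
have mi := mem_head i s.
rewrite !big_cons -IH//; last 4 first.
- by move=> j /ms; exact: fD.
- by move=> j /ms; exact: DU.
- by move=> j k c /ms js /ms ks; exact: Dij.
- by move=> j /ms; exact: dA.
pose D' := \bigcup_(j in [set` s]) D j.
apply: (@determined_independent (D i) D').
- exact: fD.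
- by apply: bigcup_finite => // j /ms; exact: fD.
- exact: DU.
- by apply: bigcup_sub => j /ms; exact: DU.
- move=> c ic [j /= js jc]; move: is_; rewrite (Dij i j c)//; last exact: ms.
  by rewrite js.
- exact: dA.
- apply: determined_bigcap => j js; apply: determinedS (dA _ (ms _ js)).
  exact: bigcup_sup.
Qed.

End Independence.

(** * Directed paths in an in-arborescence *)

Section Tree.
Variables (T : finType) (VA : {set T}) (E : rel T).
Hypothesis hA : in_arborescence VA E.

Lemma cycle_size (x : T) (q : seq T) : path (undirected E) x q ->
  uniq (x :: q) -> undirected E (last x q) x -> (size q < 2)%N.
Proof.
move=> pq uq lq; have [[_ _ _ acy] _] := hA.
by apply: (acy (x :: q)); rewrite /ucycle uq /= rcons_path pq lq.
Qed.

(* On the tree path q from x to the root, the head of every edge out of x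
   occurs, and it comes first because E has no undirected cycle. *)
Lemma out_neighbor_unique x y z : E x y -> E x z -> y = z.
Proof.
move=> xy xz; have [[EV _ con _] [r rV toward]] := hA.
have /andP[xV _] := EV _ _ xy.
have /connectP[q0 + eqr] := con _ _ xV rV.
move: eqr => + pq0; case/shortenP: pq0 => q pq uq _ /esym lq.
have head_q v : E x v -> v = head x q.
  move=> xv; have vq := toward _ _ xv _ pq uq lq.
  case/splitPr: vq pq uq {lq} => q1 q2; rewrite -cat_rcons => pq uq.
  have {}pq : path (undirected E) x (rcons q1 v).
    by move: pq; rewrite cat_path => /andP[].
  have {}uq : uniq (x :: rcons q1 v).
    by move: uq; rewrite -cat_cons cat_uniq => /and3P[].
  have := cycle_size pq uq; rewrite last_rcons size_rcons /undirected /= xv orbT.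
  by move=> /(_ isT); case: q1 {pq uq}.
by rewrite (head_q _ xy) (head_q _ xz).
Qed.

(** A simple path from [u] back to [w] closes up with the edge to an undirected cycle, so it has at
    most one edge. Then there is a loop or a reversed edge, against asymmetry. *)
Lemma no_directed_cycle u w : E w u -> ~~ connect E u w.
Proof.
move=> wu; have [[_ asym _ _] _] := hA.
apply/negP => /connectP[q0 + eqw].
move: eqw => + pq0; case/shortenP: pq0 => q pq uq _ ew.
have pq' : path (undirected E) u q.
  by apply: sub_path pq => a b; rewrite /undirected /= => ->.
have := cycle_size pq' uq; rewrite -ew /undirected /= wu => /(_ isT).
case: q pq {pq' uq} ew => [|v [|//]] /=.
  by move=> _ ew; move: (wu) (asym _ _ wu); rewrite ew => ->.
by rewrite andbT => uv ew _; move: (asym _ _ wu); rewrite ew uv.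
Qed.

(** Out-edges are unique, so the two paths from [y] run together. If one stops first, the other goes
    on through [u] and closes a directed cycle. *)
Lemma in_subtrees_disjoint u w1 w2 y : E w1 u -> E w2 u ->
  connect E y w1 -> connect E y w2 -> w1 = w2.
Proof.
move=> w1u w2u /connectP[p].
elim: p y => [|z p IH] y /=.
  move=> _ <- /connectP[[|z q] /=]; first by move=> _ ->.
  move=> /andP[w1z pq] ew2.
  have := no_directed_cycle w2u; rewrite (out_neighbor_unique w1u w1z).
  by move=> /negP[]; apply/connectP; exists q.
move=> /andP[yz pp] ew1 /connectP[[|z' q] /=].
  move=> _ ew2; have := no_directed_cycle w1u.
  rewrite -ew2 in yz; rewrite (out_neighbor_unique w2u yz).
  by move=> /negP[]; apply/connectP; exists p.
move=> /andP[yz' pq] ew2; apply: (IH z) => //; apply/connectP; exists q.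
  by rewrite (out_neighbor_unique yz yz').
by rewrite (out_neighbor_unique yz yz').
Qed.

End Tree.

(** * The process in terms of the choices on single edges *)

Section Process.
Variables (T : finType) (E : rel T) (S : {set T}) (Omega : Type).
Variables (M K : T * T -> nat -> set Omega).

Local Notation active := (active_after E S M K).
Local Notation act := (activated_at E S M K).
Local Notation met t x := (icm_state E S M K t x).2.

(* The outcomes of an edge e = (w, v) during the steps a+1, ..., t, for w
   activated at step a. *)
Fixpoint no_meeting (e : T * T) (a t : nat) (x : Omega) : bool :=
  if t is t'.+1 then
    no_meeting e a t' x && ~~ ((a <= t')%N && (x \in M e t))
  else true.

Fixpoint won (e : T * T) (a t : nat) (x : Omega) : bool :=
  if t is t'.+1 then
    won e a t' x ||
    [&& (a <= t')%N, no_meeting e a t' x, x \in M e t & x \in K e t]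
  else false.

Lemma no_meeting_refl e a t x : (t <= a)%N -> no_meeting e a t x.
Proof.
elim: t => //= t IH ta; rewrite IH ?(ltnW ta)//=.
by rewrite leqNgt ta.
Qed.

Lemma won_refl e a t x : (t <= a)%N -> won e a t x = false.
Proof.
elim: t => //= t IH ta; rewrite IH ?(ltnW ta)//=.
by rewrite leqNgt ta.
Qed.

Lemma won_not_no_meeting e a t x : won e a t x -> ~~ no_meeting e a t x.
Proof.
elim: t => //= t IH /orP[/IH nm|/and4P[-> _ -> _]]; last by rewrite andbF.
by rewrite negb_and nm.
Qed.

Lemma active_afterS v t x : v \in active t.+1 x = (v \in active t x) ||
  [exists w, [&& E w v, w \in active t x, v \notin active t x,
    x \in M (w, v) t.+1, (w, v) \notin met t x & x \in K (w, v) t.+1]].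
Proof.
rewrite /active_after /=; case: (icm_state E S M K t x) => X F /=.
rewrite finset.in_setU; congr (_ || _); apply/imsetP/existsP.
  move=> [[w v'] /=]; rewrite !finset.inE /= => /andP[/and4P[? ? ? ?] /andP[? ?]] ->.
  by exists w; apply/and5P; split=> //; apply/andP.
move=> [w /and5P[? ? ? ? /andP[? ?]]]; exists (w, v) => //.
by rewrite !finset.inE /=; apply/andP; split; [apply/and4P|apply/andP].
Qed.

Lemma metS e t x : e \in met t.+1 x = (e \in met t x) ||
  [&& E e.1 e.2, e.1 \in active t x, e.2 \notin active t x & x \in M e t.+1].
Proof.
rewrite /active_after /=; case: (icm_state E S M K t x) => X F /=.
by rewrite !finset.inE.
Qed.

Lemma active_after_mono v s t x :
  (s <= t)%N -> v \in active s x -> v \in active t x.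
Proof.
move=> /subnKC <-; elim: (t - s)%N => [|n IH]; first by rewrite addn0.
by move=> /IH vn; rewrite addnS active_afterS vn.
Qed.

Lemma activated_atS v t x :
  act v t.+1 x = (v \in active t.+1 x) && (v \notin active t x).
Proof. by []. Qed.

Lemma activated_at_active v s t x : (s <= t)%N -> act v s x -> v \in active t x.
Proof. by move=> st /andP[vs _]; exact: active_after_mono vs. Qed.

Lemma activeP v t x :
  reflect (exists2 s, (s <= t)%N & act v s x) (v \in active t x).
Proof.
apply: (iffP idP) => [|[s st /activated_at_active]]; last exact.
elim: t => [|t IH] vt; first by exists 0%N => //; rewrite /activated_at vt.
have [/IH[s st avs]|nvt] := boolP (v \in active t x).
  by exists s => //; exact: leqW.
by exists t.+1 => //; rewrite activated_atS vt nvt.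
Qed.

Lemma activated_at_unique v s t x : act v s x -> act v t x -> s = t.
Proof.
wlog st : s t / (s < t)%N.
  by move=> H ? ?; have [/H->|/H->|] := ltngtP s t.
move=> avs; case: t st => // t st /andP[_ /negP[]].
exact: activated_at_active avs.
Qed.

(** The process records meetings only while [v] is inactive, whereas [no_meeting] reads the raw
    choices. The two agree here because [v] was inactive at all steps up to [t]. *)
Lemma metP v w t x : E w v -> v \notin active t x ->
  reflect (exists t', [/\ (t' <= t)%N, act w t' x & ~~ no_meeting (w, v) t' t x])
    ((w, v) \in met t x).
Proof.
move=> wv; elim: t => [|t IH] vt.
  by rewrite /= finset.inE; constructor => -[[|?] []].
have vt' : v \notin active t x.
  by apply: contra vt; exact: active_after_mono.
rewrite metS /= wv vt' /=; apply: (iffP orP).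
  move=> [/(IH vt')[t' [tt' awt' nm]]|/andP[/activeP[t' tt' awt'] Mwv]].
    by exists t'; split=> //; [exact: leqW | rewrite /= negb_and nm].
  by exists t'; rewrite /= tt' Mwv andbF; split=> //; exact: leqW.
move=> [t' [tt' awt' nm]].
(* A node activated at step [t.+1] has had no step in which to meet [v]. *)
have {}tt' : (t' <= t)%N.
  rewrite leqNgt; apply: contra nm => ?.
  exact: (@no_meeting_refl (w, v) t' t.+1).
have wt : w \in active t x by exact: activated_at_active awt'.
move: nm; rewrite /= tt' negb_and negbK /= => /orP[nm|->]; last by right; rewrite wt.
by left; apply/(IH vt'); exists t'.
Qed.

(** Unlike the process, [won] does not ask [v] to be inactive; a win over an already active [v]
    changes nothing. The condition on each in-neighbor thereby becomes free of the other
    in-neighbors. *)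
Lemma active_wonP v t x : v \notin S ->
  reflect (exists2 w, E w v &
      exists t', [/\ (t' < t)%N, act w t' x & won (w, v) t' t x])
    (v \in active t x).
Proof.
move=> vS; elim: t => [|t IH].
  by rewrite /active_after /= (negbTE vS); constructor => -[? _ [?[]]].
apply: (iffP idP); rewrite active_afterS.
  move=> /orP[/IH[w wv [t' [tt' awt' won']]]|/existsP[w]].
    exists w => //; exists t'; split=> //; first exact: leqW.
    by rewrite /= won'.
  move=> /and5P[wv /activeP[t' tt' awt'] vt Mwv /andP[nmet Kwv]].
  exists w => //; exists t'; split=> //=; rewrite tt' Mwv Kwv !andbT /=.
  apply/orP; right; apply: contraR nmet => nm.
  by apply/(metP wv vt); exists t'.
move=> [w wv [t' [tt' awt' /=]]] /orP[won'|/and4P[_ nm Mwv Kwv]].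
  apply/orP; left; apply/IH; exists w => //; exists t'; split=> //.
  by rewrite ltnNge; apply: contraL won' => ?; rewrite won_refl.
have [//|vt] := boolP (v \in active t x); apply/existsP; exists w.
rewrite wv Mwv Kwv (activated_at_active _ awt')//= andbT.
(* A recorded meeting would follow an activation of [w], whose step is unique, and so contradict
   [nm]. *)
apply/negP => /(metP wv vt)[t'' [_ awt'' /negP[]]].
by rewrite (activated_at_unique awt'' awt').
Qed.

Definition icm_event (c : (T * T * nat) + (T * T * nat)) : set Omega :=
  match c with inl (e, t) => M e t | inr (e, t) => K e t end.

(** The window is open at [a] because a node activated at step [a] first acts at step [a.+1]. *)
Definition choices (q : pred (T * T)) (a b : nat) :
    set ((T * T * nat) + (T * T * nat)) :=
  [set c | match c with inl (e, t) | inr (e, t) =>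
    [/\ E e.1 e.2, q e & (a < t <= b)%N] end].

Lemma choices_finite q a b : finite_set (choices q a b).
Proof.
pose s := [seq (e, t) | e <- enum {: T * T}, t <- iota 0 b.+1].
have sub : choices q a b `<=` [set` map inl s ++ map inr s].
  have ins e t : (t <= b)%N -> (e, t) \in s.
    by move=> tb; apply/allpairsP; exists (e, t); rewrite mem_enum mem_iota.
  move=> c /= qc; rewrite mem_cat; apply/orP.
  by case: c qc => [[e t]|[e t]] [_ _ /andP[_ /ins es]];
     [left|right]; exact: map_f.
by apply: sub_finite_set sub _; exact: finite_seq.
Qed.

Lemma choicesS q q' a b a' b' : {subset q <= q'} -> (a' <= a)%N -> (b <= b')%N ->
  choices q a b `<=` choices q' a' b'.
Proof.
move=> qq' aa' bb'; have tt' t : (a < t <= b)%N -> (a' < t <= b')%N.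
  by move=> /andP[at_ tb]; rewrite (leq_ltn_trans aa')// (leq_trans tb).
by move=> [[e t]|[e t]] [? /qq' ? /tt' ?].
Qed.

(** For edges, this is the subtree above [w], including the edges that enter [w]. *)
Definition into (w : T) : pred (T * T) := [pred e | connect E e.2 w].

(** Active nodes and met edges feed each other, so one induction treats both. It stays inside the
    subtree because the tail of an edge leads to [w] whenever its head does. *)
Lemma determined_state w t x y :
  (forall c, choices (into w) 0 t c -> (x \in icm_event c) = (y \in icm_event c)) ->
  (forall v, connect E v w -> (v \in active t x) = (v \in active t y)) /\
  (forall e, connect E e.2 w -> (e \in met t x) = (e \in met t y)).
Proof.
elim: t => [//|t IH] xy.
have [|IHa IHm] := IH.
  by move=> c ct; apply: xy; apply: choicesS ct.
have MK e : E e.1 e.2 -> connect E e.2 w ->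
    (x \in M e t.+1) = (y \in M e t.+1) /\ (x \in K e t.+1) = (y \in K e t.+1).
  by move=> ee ew; split; [apply: (xy (inl (e, t.+1)))|apply: (xy (inr (e, t.+1)))];
     split=> //=.
have E1 u v : E u v -> connect E v w -> connect E u w.
  by move=> uv; apply: connect_trans; exact: connect1.
split=> [v vw|e ew]; last first.
  rewrite !metS IHm//; congr (_ || _).
  have [ee|//] := boolP (E e.1 e.2); have [-> _] := MK _ ee ew.
  by rewrite !IHa//; exact: E1 ew.
rewrite !active_afterS IHa//; congr (_ || _); apply: eq_existsb => u.
have [uv|//] := boolP (E u v); have [-> ->] := MK (u, v) uv vw.
by rewrite IHa ?IHm//; exact: E1 vw.
Qed.

Lemma determined_activated_at w t :
  determined icm_event (choices (into w) 0 t) [set x | act w t x].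
Proof.
move=> x y xy /=; rewrite /activated_at.
have [-> //] := determined_state xy; case: t xy => // t xy.
have [|-> //] := @determined_state w t x y.
by move=> c ct; apply: xy; apply: choicesS ct.
Qed.

Lemma determined_no_meeting e a t : E e.1 e.2 ->
  determined icm_event (choices (pred1 e) a t) [set x | no_meeting e a t x].
Proof.
move=> ee x y xy /=; rewrite (_ : no_meeting e a t y = no_meeting e a t x)//.
elim: t xy => //= t IH xy; rewrite IH; last first.
  by move=> c ct; apply: xy; apply: choicesS ct.
have [at_|//] := leqP a t.
by rewrite (xy (inl (e, t.+1)))//; split=> //=; rewrite ltnS at_ leqnn.
Qed.

Lemma determined_won e a t : E e.1 e.2 ->
  determined icm_event (choices (pred1 e) a t) [set x | won e a t x].
Proof.
move=> ee x y xy /=; rewrite (_ : won e a t y = won e a t x)//.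
elim: t xy => //= t IH xy.
have xy' c : choices (pred1 e) a t c -> (x \in icm_event c) = (y \in icm_event c).
  by move=> ct; apply: xy; apply: choicesS ct.
rewrite IH//; have [at_|//] := leqP a t.
have -> : no_meeting e a t y = no_meeting e a t x.
  by apply/idP/idP; apply: (determined_no_meeting ee) => c /xy' ->.
rewrite (xy (inl (e, t.+1))) ?(xy (inr (e, t.+1)))//.
  by split=> //=; rewrite ltnS at_ leqnn.
by split=> //=; rewrite ltnS at_ leqnn.
Qed.

End Process.

(** * Probabilities of wins and of inactivity *)

Section ActivationProbability.
Variables (R : realType) (T : finType) (VA : {set T}) (E : rel T).
Hypothesis hA : in_arborescence VA E.
Variables (p m : T -> T -> R) (S : {set T}).
Variables (d : measure_display) (Omega : measurableType d).
Variables (P : probability Omega R) (M K : T * T -> nat -> set Omega).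
Hypothesis hMK : icm_choices E P p m M K.

Local Notation F := (icm_event M K).

Definition used : set ((T * T * nat) + (T * T * nat)) :=
  [set c | match c with inl (e, t) | inr (e, t) => E e.1 e.2 /\ (0 < t)%N end].

Lemma choices_used q a b : choices E q a b `<=` used.
Proof.
by move=> [[e t]|[e t]] [ee _ /andP[at_ _]]; split=> //; exact: leq_ltn_trans at_.
Qed.

Lemma F_measurable c : used c -> measurable (F c).
Proof.
have [mMK _ _ _] := hMK.
by case: c => [[[u v] t]|[[u v] t]] [uv t0]; have [] := mMK u v t uv t0.
Qed.

Lemma F_independent : mutually_independent P used F.
Proof. by have [] := hMK. Qed.

Lemma measurable_choices q a b A : determined F (choices E q a b) A -> measurable A.
Proof.
apply: determined_measurable; first exact: choices_finite.
by move=> c /choices_used; exact: F_measurable.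
Qed.

Lemma measurable_activated_at w t :
  measurable [set x | activated_at E S M K w t x].
Proof. exact/measurable_choices/determined_activated_at. Qed.

Lemma measurable_no_meeting e a t : E e.1 e.2 ->
  measurable [set x | no_meeting M e a t x].
Proof. by move=> ee; exact/measurable_choices/determined_no_meeting. Qed.

Lemma measurable_won e a t : E e.1 e.2 -> measurable [set x | won M K e a t x].
Proof. by move=> ee; exact/measurable_choices/determined_won. Qed.

(** Each step after [a] contributes an independent factor [1 - m w u]. For [t <= a] truncated
    subtraction gives exponent 0, matching an empty window. *)
Lemma pr_no_meeting w u a t : E w u ->
  pr P [set x | no_meeting M (w, u) a t x] = (1 - m w u) ^+ (t - a).
Proof.
move=> wu; have [_ PM _ _] := hMK.
have nm1 s : (s <= a)%N -> [set x | no_meeting M (w, u) a s x] = setT.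
  by move=> sa; apply/seteqP; split=> // x _; exact: no_meeting_refl.
elim: t => [|t IH]; first by rewrite nm1// prT.
have [at_|ta] := leqP a t; last by rewrite nm1// prT (eqP ta).
have uM : used (inl ((w, u), t.+1)) by [].
have -> : [set x | no_meeting M (w, u) a t.+1 x] =
    [set x | no_meeting M (w, u) a t x] `&` ~` F (inl ((w, u), t.+1)).
  apply/seteqP; split=> x /=; rewrite at_ /=.
    by move=> /andP[-> /negP nM]; split=> // Mx; apply: nM; rewrite inE.
  by move=> [-> nM]; rewrite memNset.
rewrite (@determined_independent _ _ _ _ _ _ _ F_measurable F_independent
  (choices E (pred1 (w, u)) a t) [set inl ((w, u), t.+1)]).
- rewrite IH (prC _ (F_measurable uM)) subSn// exprSr.
  by rewrite [pr P _](_ : _ = m w u)// /pr /= PM.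
- exact: choices_finite.
- exact: finite_set1.
- exact: choices_used.
- by move=> c ->.
- by move=> [[e s]|[e s]] [_ _ /andP[_ st]] //= [_ ts]; rewrite ts ltnn in st.
- exact: determined_no_meeting.
- by apply: determinedC; exact: (@determined1 _ _ F).
Qed.

(** A win at step [t.+1] requires the first meeting to occur there, which is disjoint from earlier
    wins. It adds [p * m * (1 - m) ^+ (t - a)], the next term of a geometric sum. *)
Lemma pr_won w u a t : E w u ->
  pr P [set x | won M K (w, u) a t x] = p w u * (1 - (1 - m w u) ^+ (t - a)).
Proof.
move=> wu; have [_ PM PK _] := hMK.
have won0 s : (s <= a)%N -> [set x | won M K (w, u) a s x] = set0.
  by move=> sa; apply/seteqP; split=> // x /=; rewrite won_refl.
elim: t => [|t IH]; first by rewrite won0// pr0 expr0 subrr mulr0.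
have [at_|ta] := leqP a t; last by rewrite won0// pr0 (eqP ta) expr0 subrr mulr0.
pose Mt := inl ((w, u), t.+1) : (T * T * nat) + (T * T * nat).
pose Kt := inr ((w, u), t.+1) : (T * T * nat) + (T * T * nat).
have uM : used Mt by [].
have uK : used Kt by [].
have mMK : measurable (F Mt `&` F Kt) by apply: measurableI; exact: F_measurable.
have -> : [set x | won M K (w, u) a t.+1 x] = [set x | won M K (w, u) a t x] `|`
    ([set x | no_meeting M (w, u) a t x] `&` (F Mt `&` F Kt)).
  apply/seteqP; split=> x /=; rewrite at_ /=.
    by move=> /orP[->|/and3P[nm]]; [left|rewrite !inE; right].
  move=> [->//|[-> [Mx Kx]]].
  by rewrite (mem_set Mx) (mem_set Kx) orbT.
rewrite prU; first last.
- apply/seteqP; split=> // x /= [wx [nm _]].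
  by have := won_not_no_meeting wx; rewrite nm.
- by apply: measurableI => //; exact: measurable_no_meeting.
- exact: measurable_won.
rewrite (@determined_independent _ _ _ _ _ _ _ F_measurable F_independent
  (choices E (pred1 (w, u)) a t) [set Mt; Kt]); first last.
- by apply: determinedI; [apply: determinedS (@determined1 _ _ F Mt)
    |apply: determinedS (@determined1 _ _ F Kt)] => c ->; [left|right].
- exact: determined_no_meeting.
- by move=> [[e s]|[e s]] [_ _ /andP[_ st]] [] //= [_ ts]; rewrite ts ltnn in st.
- by move=> c [->|->].
- exact: choices_used.
- by rewrite finite_setU; split; exact: finite_set1.
- exact: choices_finite.
rewrite (@determined_independent _ _ _ _ _ _ _ F_measurable F_independent
  [set Mt] [set Kt]); first last.
- exact: determined1.
- exact: determined1.
- by move=> c ->.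
- by move=> c ->.
- by move=> c ->.
- exact: finite_set1.
- exact: finite_set1.
have prM : pr P (F Mt) = m w u by rewrite /pr /= PM.
have prK : pr P (F Kt) = p w u by rewrite /pr /= PK.
rewrite IH (pr_no_meeting a t wu) prM prK subSn// exprSr.
by ring.
Qed.

Definition won_over w u t : set Omega :=
  [set x | exists t', [/\ (t' < t)%N, activated_at E S M K w t' x
    & won M K (w, u) t' t x]].

(** The subtree above [w] together with the edge [(w, u)]. *)
Definition won_over_choices w u t : set ((T * T * nat) + (T * T * nat)) :=
  choices E [pred e | into E w e || (e == (w, u))] 0 t.

Lemma determined_won_over w u t : E w u ->
  determined F (won_over_choices w u t) (won_over w u t).
Proof.
move=> wu x y xy [t' [tt' awt' won']]; exists t'; split=> //.
  apply: (determined_activated_at _ awt') => c ct; apply: xy.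
  by apply: choicesS ct => //; [move=> e we; apply/orP; left|exact: ltnW].
apply: (determined_won (E := E) _ _ won') => // c ct; apply: xy.
by apply: choicesS ct => // e we; apply/orP; right.
Qed.

(** The events for different [t'] are disjoint since [w] is activated at most once. Within each, the
    two factors are independent: [(w, u)] is not in the subtree above [w], as [u] does not lead back
    to [w]. *)
Lemma pr_won_over w u t : E w u ->
  pr P (won_over w u t) = \sum_(0 <= t' < t)
    ap E S P M K w t' * p w u * (1 - (1 - m w u) ^+ (t - t')).
Proof.
move=> wu.
pose G t' := [set x | activated_at E S M K w t' x] `&`
             [set x | won M K (w, u) t' t x].
have mG t' : measurable (G t').
  by apply: measurableI; [exact: measurable_activated_at|exact: measurable_won].
have -> : won_over w u t = \big[setU/set0]_(t' < t) G t'.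
  rewrite -bigcup_mkord; apply/seteqP; split=> x.
    by move=> [t' [tt' ? ?]]; exists t'.
  by move=> [t' /= tt' [? ?]]; exists t'.
apply: EFin_inj; rewrite -prE; last by apply: bigsetU_measurable.
rewrite measure_bigsetU//; last first.
  by move=> i j _ _ [x [[ai _] [aj _]]]; exact: activated_at_unique ai aj.
rewrite big_mkord -sumEFin; apply: eq_bigr => t' _; rewrite [LHS](prE P (mG t')); congr EFin.
rewrite (@determined_independent _ _ _ _ _ _ _ F_measurable F_independent
  (choices E (into E w) 0 t') (choices E (pred1 (w, u)) t' t)).
- by rewrite pr_won// mulrA.
- exact: choices_finite.
- exact: choices_finite.
- exact: choices_used.
- exact: choices_used.
- by move=> [[e s]|[e s]] [_ ew _] [_ /eqP eE _];
     rewrite eE in ew; case/negP: (no_directed_cycle hA wu).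
- exact: determined_activated_at.
- exact: determined_won.
Qed.

Definition inactive u t : set Omega := [set x | u \notin active_after E S M K t x].

Lemma measurable_inactive u t : measurable (inactive u t).
Proof.
apply: (@measurable_choices (into E u) 0 t) => x y xy.
by rewrite /inactive /= ((determined_state S xy).1 u).
Qed.

(* The in-neighbours of u influence it through disjoint sets of edges. *)
Lemma pr_inactive u t : u \notin S ->
  pr P (inactive u t) = \prod_(w in in_neighbors VA E u)
    (1 - \sum_(0 <= t' < t)
           ap E S P M K w t' * p w u * (1 - (1 - m w u) ^+ (t - t'))).
Proof.
move=> uS; have [[EV _ _ _] _] := hA.
have NE w : (w \in in_neighbors VA E u) = E w u.
  by rewrite inE andbC; case wu: (E w u) => //=; case/andP: (EV _ _ wu).
have NE' w : w \in enum (in_neighbors VA E u) -> E w u by rewrite mem_enum NE.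
have -> : inactive u t =
    \big[setI/setT]_(w <- enum (in_neighbors VA E u)) ~` won_over w u t.
  rewrite -bigcap_seq; apply/seteqP; split=> x.
    move=> ux w /= /NE' wu [t' won']; move/negP: ux; apply.
    by apply/active_wonP => //; exists w => //; exists t'.
  move=> H; apply/negP => /(active_wonP _ _ _ _ _ uS)[w wu [t' won']].
  by apply: (H w); [rewrite /= mem_enum NE|exists t'].
rewrite (@determined_independent_big _ _ _ _ _ _ _ F_measurable F_independent _ _
  (fun w => won_over_choices w u t)).
- rewrite big_enum; apply: eq_bigr => w; rewrite NE => wu.
  by rewrite prC ?pr_won_over//; exact: measurable_choices (determined_won_over wu).
- exact: enum_uniq.
- by move=> w _; exact: choices_finite.
- by move=> w _; exact: choices_used.
- move=> w1 w2 c /NE' wu1 /NE' wu2.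
  (* A shared edge lies in both subtrees, or is an edge into [u] lying in a subtree, which closes a
     cycle, or is both [(w1, u)] and [(w2, u)]. *)
  have disj e : into E w1 e || (e == (w1, u)) -> into E w2 e || (e == (w2, u)) -> w1 = w2.
    move=> /orP[e1|/eqP ->] /orP[|/eqP].
    - exact: (in_subtrees_disjoint hA wu1 wu2 e1).
    - by move=> eE; rewrite eE in e1; case/negP: (no_directed_cycle hA wu1).
    - by move=> e2; case/negP: (no_directed_cycle hA wu2).
    - by case.
  by case: c => [[e s]|[e s]] [_ e1 _] [_ e2 _]; exact: disj e1 e2.
- by move=> w /NE' wu; exact/determinedC/determined_won_over.
Qed.

Lemma ap_seed u : u \in S -> ap E S P M K u 0 = 1.
Proof.
move=> uS; rewrite -(prT P) /ap /pr; congr (fine (P _)).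
by apply/seteqP; split=> // x _; rewrite /= /activated_at /active_after /= uS.
Qed.

Lemma ap_nonseed u : u \notin S -> ap E S P M K u 0 = 0.
Proof.
move=> uS; rewrite -(pr0 P) /ap /pr; congr (fine (P _)).
apply/seteqP; split=> // x.
by rewrite /= /activated_at /active_after /= (negbTE uS).
Qed.

Lemma ap_seedS u t : u \in S -> ap E S P M K u t.+1 = 0.
Proof.
move=> uS; rewrite -(pr0 P) /ap /pr; congr (fine (P _)).
apply/seteqP; split=> // x; rewrite /= activated_atS => /andP[_ /negP[]].
exact: (@active_after_mono _ _ _ _ _ _ u 0).
Qed.

(** Inactivity after [t.+1] implies inactivity after [t], and activation at [t.+1] is exactly the
    difference of these events. *)
Lemma ap_nonseedS u t :
  ap E S P M K u t.+1 = pr P (inactive u t) - pr P (inactive u t.+1).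
Proof.
rewrite (pr_splitI P (measurable_inactive u t) (measurable_inactive u t.+1)).
have -> : inactive u t `&` inactive u t.+1 = inactive u t.+1.
  apply/setIidr => x; apply: contra; exact: active_after_mono.
rewrite addrC addKr /ap /pr; congr (fine (P _)).
apply/seteqP; split=> x; rewrite /inactive /= activated_atS.
  by move=> /andP[u1 u0]; split=> //; rewrite u1.
by move=> [u0 /negP]; rewrite negbK => u1; rewrite u1.
Qed.

End ActivationProbability.

(** * The recursion for the activation probabilities *)

Theorem theorem5 (R : realType) (T : finType)
  (* the in-arborescence A = (VA, E) *)
  (VA : {set T}) (E : rel T) (hA : in_arborescence VA E)
  (p m : T -> T -> R)
  (hp : forall u v, E u v -> 0 <= p u v <= 1)
  (hm : forall u v, E u v -> 0 <= m u v <= 1)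
  (S : {set T}) (hS : exists2 s, s \in S & s \in VA)
  (tau : nat)
  (* the probability space of the IC-M process and its random choices *)
  (d : measure_display) (Omega : measurableType d) (P : probability Omega R)
  (M K : T * T -> nat -> set Omega) (hMK : icm_choices E P p m M K)
  (u : T) (hu : u \in VA) (t : nat) (ht : (t <= tau)%N) :
  let a := ap E S P M K in
  [/\ u \in S -> t = 0%N -> a u t = 1,
      u \notin S -> t = 0%N -> a u t = 0,
      u \in S -> (1 <= t)%N -> a u t = 0
    & u \notin S -> (1 <= t)%N ->
      a u t =
        \prod_(w in in_neighbors VA E u)
          (1 - \sum_(0 <= t' < t.-1)
                 a w t' * p w u * (1 - (1 - m w u) ^+ (t - t' - 1)))
      - \prod_(w in in_neighbors VA E u)
          (1 - \sum_(0 <= t' < t)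
                 a w t' * p w u * (1 - (1 - m w u) ^+ (t - t')))].
Proof.
move=> a; split.
- by move=> uS ->; exact: ap_seed.
- by move=> uS ->; exact: ap_nonseed.
- by case: t {ht} => // t uS _; exact: ap_seedS.
- case: t {ht} => // t uS _.
  rewrite [LHS](ap_nonseedS S hMK) !(pr_inactive hA hMK)//.
  congr (_ - _); apply: eq_bigr => w _; congr (_ - _).
  (* With [t.+1] for [t], the exponent [t.+1 - t' - 1] of the first product is [t - t'], also under
     truncated subtraction. *)
  by apply: eq_bigr => t' _; rewrite subnAC subn1.
Qed.
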